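(* Let $K$ be a field, $Q$ a finite quiver, $\succ$ a length admissible order on the set $\mathcal B$ of paths of $Q$, and let $\mathcal T$ be a set of paths of length $2$ in $Q$. Then $\mathrm{GrAlg}(\mathcal T)$ is an affine algebraic variety in the affine space $\mathcal A=K^D$, i.e. it is the common zero set in $K^D$ of a set of polynomials with coefficients in $K$ in $D$ commuting variables.
   Context: $KQ$ is the path algebra, $\mathcal B$ the set of all finite directed paths in $Q$ (vertices are paths of length $0$), $\ell(p)$ the length of a path; paths are written left to right, so a path $p$ from $v$ to $w$ satisfies $vpw=p$. ''Ideal'' means two-sided ideal and $\langle X\rangle$ is the two-sided ideal generated by $X$. A length admissible order is a well-order $\succ$ on $\mathcal B$ such that for $p,q,r,s,t\in\mathcal B$: $p\succ q$ implies $pr\succ qr$ if both are nonzero; $p\succ q$ implies $sp\succ sq$ if both are nonzero; $p=rqt$ implies $p\succeq q$; and $\ell(p)>\ell(q)$ implies $p\succ q$. For nonzero $x=\sum_{p\in\mathcal B}\alpha_p p\in KQ$, $\mathrm{tip}(x)$ is the $\succ$-largest $p$ with $\alpha_p\neq 0$; for $X\subseteq KQ$, $\mathrm{tip}(X)=\{\mathrm{tip}(x): x\in X, x\ne 0\}$. A nonzero $x$ is uniform if $x=vxw$ for some vertices $v,w$; an element is quadratic if it is a $K$-linear combination of paths of length $2$. An ideal is graded if it is generated by length homogeneous elements. A Gröbner basis of a graded ideal $I$ is a set $\mathcal G\subseteq I$ of length homogeneous uniform elements with $\langle\mathrm{tip}(\mathcal G)\rangle=\langle \mathrm{tip}(I)\rangle$.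 $KQ/I$ is a strong Koszul algebra (with respect to $I$ and $\succ$) if $I$ has a Gröbner basis with respect to $\succ$ consisting of quadratic elements. Given $\mathcal T$: $\mathcal N=\mathcal B\setminus \mathrm{tip}(\langle\mathcal T\rangle)$ (the paths having no subpath in $\mathcal T$); $\mathcal N_2$ is the set of paths of length $2$ in $\mathcal N$; for $t\in\mathcal T$, $\mathcal N_2(t)$ is the set of $n\in\mathcal N_2$ with $t\succ n$ and $n$ having the same start vertex and the same end vertex as $t$. Put $D=\sum_{t\in\mathcal T}|\mathcal N_2(t)|$ and $\mathcal A=K^D$, with points written $X=(x_{t,n})_{t\in\mathcal T,\,n\in\mathcal N_2(t)}$. For $X\in\mathcal A$, $\mathcal G(X)=\{g_t : t\in\mathcal T\}$ with $g_t=t-\sum_{n\in\mathcal N_2(t)}x_{t,n}n$. Finally $\mathrm{GrAlg}(\mathcal T)=\{X\in\mathcal A : KQ/\langle \mathcal G(X)\rangle$ is a strong Koszul algebra with respect to $\langle\mathcal G(X)\rangle$ and $\succ\}$. *)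

(* Defs.v *)
From HB Require Import structures.
From mathcomp Require Import all_boot all_order all_algebra finmap.
From mathcomp Require Import boolp classical_sets functions cardinality.
From mathcomp Require wochoice.
(* The monalg notations clash with those of mpoly (in particular both declare
   {mpoly R[n]}), and the names msupp and mcoeff denote the mpoly versions once
   mpoly is imported: the monalg ones are then monalg.msupp and monalg.mcoeff. *)
From mathcomp.multinomials Require Import -(notations) monalg.

Set Implicit Arguments.
Unset Strict Implicit.
Unset Printing Implicit Defensive.

Import GRing.Theory.

Local Open Scope classical_set_scope.
Local Open Scope ring_scope.

Record quiver := Quiver {
  vertex : finType;
  arrow : finType;
  source : arrow -> vertex;
  target : arrow -> vertex
}.

Fixpoint is_qpath (Q : quiver) (v : vertex Q) (s : seq (arrow Q)) : bool :=
  if s is a :: s' then (source a == v) && is_qpath (target a) s' else true.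

(* A path is its start vertex together with its arrows read from left to right;
   the start vertex tells the paths of length 0 apart. *)
Record qpath (Q : quiver) := QPath {
  qpath_val :> vertex Q * seq (arrow Q);
  _ : is_qpath qpath_val.1 qpath_val.2
}.

HB.instance Definition _ (Q : quiver) := [isSub for @qpath_val Q].
HB.instance Definition _ (Q : quiver) := [Countable of qpath Q by <:].

Section Paths.
Variable Q : quiver.
Implicit Types p q r : qpath Q.

Definition parrows p : seq (arrow Q) := (val p).2.
Definition plength p : nat := size (parrows p).
Definition pstart p : vertex Q := (val p).1.
Definition pend p : vertex Q := last (pstart p) (map (@target Q) (parrows p)).

Definition pvertex (v : vertex Q) : qpath Q :=
  @QPath Q (v, [::]) isT.

(* None encodes a product of paths that is 0 in the path algebra. *)
Definition pcat p q : option (qpath Q) :=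
  if pend p == pstart q then insub (pstart p, parrows p ++ parrows q) else None.

Lemma is_qpath_cat v s1 s2 :
  @is_qpath Q v (s1 ++ s2) =
  is_qpath v s1 && is_qpath (last v (map (@target Q) s1)) s2.
Proof. by elim: s1 v => //= a s1 IH v; rewrite IH andbA. Qed.

Lemma pcatP p q r :
  pcat p q = Some r <->
  [/\ pend p = pstart q, pstart r = pstart p & parrows r = parrows p ++ parrows q].
Proof.
rewrite /pcat; split.
  case: eqP => // epq; case: insubP => //= u _ eu [<-].
  by rewrite /pstart /parrows /= eu.
case=> -> er1 er2; rewrite eqxx.
have -> : (pstart p, parrows p ++ parrows q) = val r.
  by rewrite -er1 -er2 /pstart /parrows; case: (val r).
by rewrite valK.
Qed.

Lemma pcat_ex p q : pend p = pstart q -> exists r, pcat p q = Some r.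
Proof.
move=> epq; rewrite /pcat epq eqxx.
case: insubP => [u _ _|]; first by exists u.
rewrite /= is_qpath_cat negb_and => /orP[].
  by rewrite (valP p).
by rewrite -/(pend p) epq (valP q).
Qed.

Lemma pcat_None p q : pend p <> pstart q -> pcat p q = None.
Proof. by rewrite /pcat; case: eqP. Qed.

Lemma pend_pcat p q r : pcat p q = Some r -> pend r = pend q.
Proof.
case/pcatP => epq er1 er2.
by rewrite /pend er2 map_cat last_cat er1 -[last (pstart p) _]/(pend p) epq.
Qed.

Lemma pstart_pcat p q r : pcat p q = Some r -> pstart r = pstart p.
Proof. by case/pcatP. Qed.

Lemma plength_pcat p q r : pcat p q = Some r -> plength r = (plength p + plength q)%N.
Proof. by case/pcatP => _ _; rewrite /plength => ->; rewrite size_cat. Qed.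

Lemma qpathP p q : pstart p = pstart q -> parrows p = parrows q -> p = q.
Proof.
rewrite /pstart /parrows => e1 e2; apply: val_inj.
by move: e1 e2; case: (val p) (val q) => [? ?] [? ?] /= -> ->.
Qed.

Lemma pcatA p q r : obind (pcat p) (pcat q r) = obind (fun s => pcat s r) (pcat p q).
Proof.
have [epq|npq] := EM (pend p = pstart q); last first.
  rewrite (pcat_None npq) /=; case eqr: (pcat q r) => [s|] //=.
  by apply: pcat_None; rewrite (pstart_pcat eqr).
have [s es] := pcat_ex epq; rewrite es /=.
have [eqr|nqr] := EM (pend q = pstart r); last first.
  by rewrite !pcat_None //= (pend_pcat es).
have [t et] := pcat_ex eqr; rewrite et /=.
have [u eu] : exists u, pcat p t = Some u.
  by apply: pcat_ex; rewrite (pstart_pcat et).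
rewrite eu; apply/esym/pcatP; split.
- by rewrite (pend_pcat es).
- by rewrite (pstart_pcat eu) (pstart_pcat es).
- move/pcatP: eu => [_ _ ->]; move/pcatP: et => [_ _ ->].
  by move/pcatP: es => [_ _ ->]; rewrite catA.
Qed.

Lemma pcat_vertexl v q : pcat (pvertex v) q = if v == pstart q then Some q else None.
Proof.
have [->|nv] := eqVneq; last by apply: pcat_None; apply/eqP.
by apply/pcatP.
Qed.

Lemma pcat_vertexr v q : pcat q (pvertex v) = if v == pend q then Some q else None.
Proof.
have [->|nv] := eqVneq; last by apply: pcat_None; apply/eqP; rewrite eq_sym.
by apply/pcatP; split=> //; rewrite /= cats0.
Qed.

End Paths.

Definition pathalg (K : fieldType) (Q : quiver) := malg (qpath Q) K.

HB.instance Definition _ (K : fieldType) (Q : quiver) :=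
  GRing.Lmodule.on (pathalg K Q).

Section PathAlgebra.
Local Open Scope fset_scope.
Local Open Scope ring_scope.
Variables (K : fieldType) (Q : quiver).
Local Notation KQ := (pathalg K Q).
Implicit Types (x y z : KQ) (p q r : qpath Q) (o : option (qpath Q)).

Definition pbase p : KQ := mkmalgU p 1.

Definition pterm (c : K) o : KQ := if o is Some p then mkmalgU p c else 0.

Definition pa_one : KQ := \sum_(v : vertex Q) pbase (pvertex v).

Definition pa_mul x y : KQ :=
  \sum_(p <- msupp x) \sum_(q <- msupp y) pterm (mcoeff p x * mcoeff q y) (pcat p q).

Lemma pterm0 o : pterm 0 o = 0.
Proof. by case: o => //= p; rewrite monalgU0. Qed.

Lemma ptermD c d o : pterm (c + d) o = pterm c o + pterm d o.
Proof. by case: o => /= [p|]; rewrite ?monalgUD ?addr0. Qed.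

Lemma mkmalgUZ (c d : K) p : mkmalgU p (c * d) = c *: mkmalgU p d :> KQ.
Proof.
by apply/malgP => k; rewrite mcoeffZ [LHS]mcoeffU (mcoeffU p d k) mulrnAr.
Qed.

Lemma ptermZ c d o : pterm (c * d) o = c *: pterm d o.
Proof.
by case: o => [p|]; [exact: mkmalgUZ | rewrite scaler0].
Qed.

Lemma pa_mulw (d1 d2 : {fset qpath Q}) x y :
  msupp x `<=` d1 -> msupp y `<=` d2 ->
  pa_mul x y = \sum_(p <- d1) \sum_(q <- d2) pterm (mcoeff p x * mcoeff q y) (pcat p q).
Proof.
move=> le1 le2; rewrite /pa_mul (big_fset_incl _ le1) /=.
  apply: eq_bigr => p _; apply: big_fset_incl => // q _ /mcoeff_outdom ->.
  by rewrite mulr0 pterm0.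
move=> p _ /mcoeff_outdom xp.
by rewrite big1 // => q _; rewrite xp mul0r pterm0.
Qed.

Lemma pa_mulDl : left_distributive pa_mul +%R.
Proof.
move=> x y z.
rewrite (pa_mulw (msuppD_le x y) (fsubset_refl _)).
rewrite (pa_mulw (fsubsetUl _ (msupp y)) (fsubset_refl (msupp z))).
rewrite (pa_mulw (fsubsetUr (msupp x) _) (fsubset_refl (msupp z))).
rewrite -big_split; apply: eq_bigr => p _ /=.
rewrite -big_split; apply: eq_bigr => q _ /=.
by rewrite mcoeffD mulrDl ptermD.
Qed.

Lemma pa_mulDr : right_distributive pa_mul +%R.
Proof.
move=> z x y.
rewrite (pa_mulw (fsubset_refl _) (msuppD_le x y)).
rewrite (pa_mulw (fsubset_refl (msupp z)) (fsubsetUl _ (msupp y))).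
rewrite (pa_mulw (fsubset_refl (msupp z)) (fsubsetUr (msupp x) _)).
rewrite -big_split; apply: eq_bigr => p _ /=.
rewrite -big_split; apply: eq_bigr => q _ /=.
by rewrite mcoeffD mulrDr ptermD.
Qed.

Lemma pa_mul0l x : pa_mul 0 x = 0.
Proof. by rewrite /pa_mul msupp0 big_seq_fset0. Qed.

Lemma pa_mul0r x : pa_mul x 0 = 0.
Proof. by rewrite /pa_mul big1 // => p _; rewrite msupp0 big_seq_fset0. Qed.

Lemma pa_mulUU c d p q : pa_mul (mkmalgU p c) (mkmalgU q d) = pterm (c * d) (pcat p q).
Proof. by rewrite (pa_mulw msuppU_le msuppU_le) !big_seq_fset1 !mcoeffUU. Qed.

Lemma pa_mulUt c d p o : pa_mul (mkmalgU p c) (pterm d o) = pterm (c * d) (obind (pcat p) o).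
Proof. by case: o => /= [q|]; rewrite ?pa_mulUU ?pa_mul0r. Qed.

Lemma pa_multU c d p o : pa_mul (pterm c o) (mkmalgU p d) = pterm (c * d) (obind (fun q => pcat q p) o).
Proof. by case: o => /= [q|]; rewrite ?pa_mulUU ?pa_mul0l. Qed.

Lemma pa_mul_suml I (s : seq I) (F : I -> KQ) y :
  pa_mul (\sum_(i <- s) F i) y = \sum_(i <- s) pa_mul (F i) y.
Proof. exact: (big_morph (pa_mul^~ y) (fun a b => pa_mulDl a b y) (pa_mul0l y)). Qed.

Lemma pa_mul_sumr I (s : seq I) (F : I -> KQ) y :
  pa_mul y (\sum_(i <- s) F i) = \sum_(i <- s) pa_mul y (F i).
Proof. exact: (big_morph (pa_mul y) (pa_mulDr y) (pa_mul0r y)). Qed.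

Lemma pa_mulA : associative pa_mul.
Proof.
have E1 u v : pa_mul u v = \sum_(p <- msupp u) pa_mul (mkmalgU p (mcoeff p u)) v.
  by rewrite {1}[u]monalgE pa_mul_suml.
have E2 u v : pa_mul u v = \sum_(p <- msupp v) pa_mul u (mkmalgU p (mcoeff p v)).
  by rewrite {1}[v]monalgE pa_mul_sumr.
have A0 c d e p q r : let u := mkmalgU p c in let v := mkmalgU q d in
    let w := mkmalgU r e in pa_mul u (pa_mul v w) = pa_mul (pa_mul u v) w.
  move=> u v w.
  rewrite /= (congr1 (pa_mul u) (pa_mulUU d e q r) : pa_mul u (pa_mul v w) = _).
  rewrite (congr1 (pa_mul^~ w) (pa_mulUU c d p q) : pa_mul (pa_mul u v) w = _).
  by rewrite (pa_mulUt c (d * e) p) (pa_multU (c * d) e r) mulrA pcatA.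
have A1 c d p q z : let u := mkmalgU p c in let v := mkmalgU q d in
    pa_mul u (pa_mul v z) = pa_mul (pa_mul u v) z.
  move=> u v; move: {A0}(fun r e => A0 c d e p q r) => /=.
  rewrite -/u -/v; move: u v => u v A0.
  rewrite (E2 v z) (E2 (pa_mul u v) z) pa_mul_sumr.
  by apply: eq_bigr => r _; apply: A0.
have A2 c p y z : let u := mkmalgU p c in
    pa_mul u (pa_mul y z) = pa_mul (pa_mul u y) z.
  move=> u; move: {A1}(fun q d => A1 c d p q z) => /=.
  rewrite -/u; move: u => u A1.
  rewrite (E1 y z) (E2 u y) pa_mul_sumr pa_mul_suml.
  by apply: eq_bigr => q _; apply: A1.
move=> x y z; rewrite (E1 x (pa_mul y z)) (E1 x y) pa_mul_suml.
by apply: eq_bigr => p _; apply: A2.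
Qed.

Lemma pa_mul1l : left_id pa_one pa_mul.
Proof.
move=> x; rewrite [x in LHS]monalgE [RHS]monalgE pa_mul_sumr.
apply: eq_bigr => p _; rewrite pa_mul_suml (bigD1 (pstart p)) //=.
rewrite (pa_mulUU 1 _ (pvertex _) p) pcat_vertexl eqxx mul1r big1 ?addr0 // => v /negbTE nv.
by rewrite (pa_mulUU 1 _ (pvertex v) p) pcat_vertexl nv.
Qed.

Lemma pa_mul1r : right_id pa_one pa_mul.
Proof.
move=> x; rewrite [x in LHS]monalgE [RHS]monalgE pa_mul_suml.
apply: eq_bigr => p _; rewrite pa_mul_sumr (bigD1 (pend p)) //=.
rewrite (pa_mulUU _ 1 p (pvertex _)) pcat_vertexr eqxx mulr1 big1 ?addr0 // => v /negbTE nv.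
by rewrite (pa_mulUU _ 1 p (pvertex v)) pcat_vertexr nv.
Qed.

(* Only a possibly zero ring, as the quiver may have no vertex. *)
HB.instance Definition _ := GRing.Zmodule_isPzRing.Build (pathalg K Q)
  pa_mulA pa_mul1l pa_mul1r pa_mulDl pa_mulDr.

Lemma pa_scaleAl (c : K) x y : c *: (x * y) = (c *: x) * y.
Proof.
rewrite -[RHS]/(pa_mul _ _) (pa_mulw (msuppZ_le c x) (fsubset_refl _)).
rewrite scaler_sumr; apply: eq_bigr => p _.
rewrite scaler_sumr; apply: eq_bigr => q _.
by rewrite mcoeffZ -mulrA -ptermZ.
Qed.

Lemma pa_scaleAr (c : K) x y : c *: (x * y) = x * (c *: y).
Proof.
rewrite -[RHS]/(pa_mul _ _) (pa_mulw (fsubset_refl _) (msuppZ_le c y)).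
rewrite scaler_sumr; apply: eq_bigr => p _.
rewrite scaler_sumr; apply: eq_bigr => q _.
by rewrite mcoeffZ mulrCA -ptermZ.
Qed.

Lemma pbaseM p q : pbase p * pbase q = if pcat p q is Some r then pbase r else 0.
Proof. by rewrite -[LHS]/(pa_mul _ _) pa_mulUU mul1r. Qed.

End PathAlgebra.

Section Ideals.
Variable R : pzRingType.

(* In the path algebra, which is unital and contains K in its centre, these are
   automatically K-subspaces. *)
Definition two_sided_ideal (I : set R) : Prop :=
  [/\ I 0, forall x y, I x -> I y -> I (x - y) &
      forall a x b, I x -> I (a * x * b)].

Definition ideal_gen (X : set R) : set R :=
  [set x | forall I, two_sided_ideal I -> X `<=` I -> I x].

End Ideals.

Section Order.
Variables (Q : quiver) (le : rel (qpath Q)).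
Implicit Types p q r s t : qpath Q.

(* le is the weak order; psucc p q is its strict converse, "p is strictly larger than q". *)
Definition psucc p q := (q != p) && le q p.

Record length_admissible : Prop := LengthAdmissible {
  la_wo : wochoice.well_order le;
  la_mulr : forall p q r pr qr,
    pcat p r = Some pr -> pcat q r = Some qr -> psucc p q -> psucc pr qr;
  la_mull : forall p q s sp sq,
    pcat s p = Some sp -> pcat s q = Some sq -> psucc p q -> psucc sp sq;
  la_sub : forall p q r t rq,
    pcat r q = Some rq -> pcat rq t = Some p -> le q p;
  la_length : forall p q, (plength q < plength p)%N -> psucc p q
}.

End Order.

Section Koszul.
Variables (K : fieldType) (Q : quiver) (le : rel (qpath Q)).
Local Notation KQ := (pathalg K Q).

Definition is_tip (x : KQ) (p : qpath Q) : Prop :=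
  p \in msupp x /\ {in msupp x, forall q, le q p}.

Definition tip (X : set KQ) : set (qpath Q) :=
  [set p | exists x, [/\ X x, x != 0 & is_tip x p]].

Definition homogeneous (x : KQ) : Prop :=
  exists n, {in msupp x, forall p, plength p = n}.

Definition uniform (x : KQ) : Prop :=
  x != 0 /\ exists v w, x = pbase K (pvertex v) * x * pbase K (pvertex w).

Definition quadratic (x : KQ) : Prop := {in msupp x, forall p, plength p = 2%N}.

Definition graded_ideal (I : set KQ) : Prop :=
  exists2 X : set KQ, X `<=` homogeneous & I = ideal_gen X.

Definition path_ideal (S : set (qpath Q)) : set KQ := ideal_gen (@pbase K Q @` S).

Definition groebner_basis (I G : set KQ) : Prop :=
  [/\ graded_ideal I, G `<=` I, (forall g, G g -> homogeneous g /\ uniform g) &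
      path_ideal (tip G) = path_ideal (tip I)].

Definition strong_koszul (I : set KQ) : Prop :=
  exists2 G : set KQ, groebner_basis I G & G `<=` quadratic.

End Koszul.

Section GrAlg.
Variables (K : fieldType) (Q : quiver) (le : rel (qpath Q)) (T : {fset qpath Q}).
Local Notation KQ := (pathalg K Q).
Implicit Types (t n : qpath Q).

Definition normal_paths : set (qpath Q) :=
  ~` tip le (@path_ideal K Q [set` T]).

Definition normal2_set t : set (qpath Q) :=
  [set n | [/\ normal_paths n, plength n = 2%N, psucc le t n &
               pstart n = pstart t /\ pend n = pend t]].

Lemma finite_plength (m : nat) : finite_set [set p : qpath Q | plength p = m].
Proof.
pose f (x : vertex Q * m.-tuple (arrow Q)) : option (qpath Q) :=
  insub (x.1, tval x.2).
have fS : finite_set (Some @^-1` (f @` [set: vertex Q * m.-tuple (arrow Q)])).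
  apply: finite_preimage; first by move=> ? ? _ _ [].
  by apply: finite_image; apply: finite_finset.
apply: sub_finite_set fS => p /= /eqP lp.
exists (pstart p, Tuple lp) => //; rewrite /f /=.
have -> : (pstart p, parrows p) = val p by rewrite /pstart /parrows; case: (val p).
by rewrite valK.
Qed.

Lemma finite_normal2 t : finite_set (normal2_set t).
Proof. by apply: sub_finite_set (finite_plength 2) => n []. Qed.

Definition normal2 t : {fset qpath Q} := fset_set (normal2_set t).

Lemma normal2P t n : reflect (normal2_set t n) (n \in normal2 t).
Proof.
by rewrite in_fset_set; [apply: (iffP idP) => /[!inE] | apply: finite_normal2].
Qed.

Definition coord : finType := {t : T & normal2 (val t)}.

Definition nb_coord : nat := #|{: coord}|.

Lemma nb_coordE : nb_coord = (\sum_(t : T) #|` normal2 (val t)|)%N.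
Proof.
rewrite /nb_coord card_tagged sumnE big_map big_enum /=.
by apply: eq_bigr => t _; rewrite cardfE.
Qed.

Definition affine_space := 'I_nb_coord -> K.

Definition coordinate (X : affine_space) (t : T) (n : normal2 (val t)) : K :=
  X (enum_rank (Tagged (fun t : T => normal2 (val t)) n : coord)).

Definition gelt (X : affine_space) (t : T) : KQ :=
  pbase K (val t) - \sum_(n : normal2 (val t)) coordinate X n *: pbase K (val n).

Definition gset (X : affine_space) : set KQ := range (gelt X).

Definition GrAlg : set affine_space :=
  [set X | strong_koszul le (ideal_gen (gset X))].

End GrAlg.

From mathcomp.multinomials Require Import mpoly.

Definition affine_variety (K : fieldType) (n : nat) (S : set ('I_n -> K)) : Prop :=
  exists F : set {mpoly K[n]}, S = [set X | forall f, F f -> f.@[X] = 0].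

(* Main.v *)
Require Import Defs.
From mathcomp Require Import all_boot all_order all_algebra finmap.
From mathcomp Require Import boolp classical_sets.
From mathcomp Require wochoice.
From mathcomp.multinomials Require Import -(notations) monalg.
From mathcomp.multinomials Require Import mpoly.

(** Write I(X) for the ideal generated by the g_t, and call a path normal when
no element of T is a subpath of it.

Reduction to a linear condition.  The algebra KQ/I(X) is strong Koszul exactly
when 0 is the only element of I(X) that is a combination of normal paths
(GrAlgP).  If there is a quadratic Groebner basis G, then the elements of G are
combinations of the g_t, because I(X) has nothing else in degree 2; their tips
are therefore in T, since a normal path n occurring in g_t is smaller than t
(quadratic_tip).  So the tip of any nonzero element of I(X) contains an element
of T, and is not normal.  Conversely, under the linear condition the g_t
themselves are a Groebner basis: the tip p of some x in I(X) must contain an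
element of T, for otherwise p would survive in the normal form of x, which is a
combination of normal paths in I(X).

Equations.  Replacing repeatedly a subpath t by the sum of the x_{t,n} n
terminates because the order is a well-order, and gives a linear map NF_X from
KQ onto the span of the normal paths, with NF_X(x) congruent to x modulo I(X),
with NF_X the identity on normal paths, and such that every coefficient of
NF_X(p) is polynomial in X (normal_form_ex).  For each path one sequence of
reductions is chosen, the same one for all X.  The linear condition then says
that NF_X kills I(X), that is, NF_X(u g_t v) = 0 for all paths u, v and all t in
T; the coefficients of the NF_X(u g_t v) are the polynomials that cut out
GrAlg(T). *)

Set Implicit Arguments.
Unset Strict Implicit.
Unset Printing Implicit Defensive.

Import GRing.Theory.

(** * Products of three paths and subpaths *)

Section PathProducts.
Variable Q : quiver.
Implicit Types p q r u v : qpath Q.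

Definition pcat3 u q v : option (qpath Q) := obind (fun s => pcat s v) (pcat u q).

Lemma pcat3P u q v r :
  pcat3 u q v = Some r <->
  [/\ pend u = pstart q, pend q = pstart v, pstart r = pstart u &
      parrows r = parrows u ++ parrows q ++ parrows v].
Proof.
rewrite /pcat3; split.
  case E: (pcat u q) => [s|] //= F; move: (pend_pcat E).
  by case/pcatP: E => -> e1 e2 e3; case/pcatP: F => <- -> ->; rewrite e1 e2 e3 -catA.
case=> e1 e2 e3 e4; have [s es] := pcat_ex e1; rewrite es /=.
apply/pcatP; rewrite (pend_pcat es); move/pcatP: es => [_ -> ->].
by rewrite -catA.
Qed.

Lemma plength_pcat3 u q v r :
  pcat3 u q v = Some r -> plength r = (plength u + (plength q + plength v))%N.
Proof. by move/pcat3P => [_ _ _]; rewrite /plength => ->; rewrite !size_cat. Qed.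

Lemma pcat3_ex u q v :
  pend u = pstart q -> pend q = pstart v -> exists r, pcat3 u q v = Some r.
Proof.
move=> e1 e2; have [s es] := pcat_ex e1.
by rewrite /pcat3 es; apply: pcat_ex; rewrite (pend_pcat es).
Qed.

Lemma pcat3_vertices q : pcat3 (pvertex (pstart q)) q (pvertex (pend q)) = Some q.
Proof. by apply/pcat3P; split=> //; rewrite /= cats0. Qed.

Lemma plength0 u : plength u = 0%N -> u = pvertex (pstart u).
Proof. by move=> /size0nil e; apply: qpathP. Qed.

Lemma pend_plength0 u : plength u = 0%N -> pend u = pstart u.
Proof. by rewrite /pend => /size0nil ->. Qed.

(** The counterpart on paths of membership in the monomial ideal generated by S,
see path_idealP. *)
Definition contains (S : set (qpath Q)) p : Prop :=
  exists u q v, S q /\ pcat3 u q v = Some p.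

Lemma contains_refl (S : set (qpath Q)) p : S p -> contains S p.
Proof.
move=> Sp; exists (pvertex (pstart p)), p, (pvertex (pend p)).
by rewrite pcat3_vertices.
Qed.

Lemma contains_trans (S1 S2 : set (qpath Q)) p :
  (forall q, S1 q -> contains S2 q) -> contains S1 p -> contains S2 p.
Proof.
move=> S12 [u [q [v [/S12 [u' [s [v' [Ss /pcat3P[a1 a2 a3 a4]]]]] /pcat3P[b1 b2 b3 b4]]]]].
have eu : pend u = pstart u' by rewrite b1 a3.
have ev : pend v' = pstart v.
  rewrite -b2 [in RHS]/pend a4 a3 !map_cat !last_cat.
  rewrite -[last (pstart u') _]/(pend u') a1 -[last (pstart s) _]/(pend s) a2.
  by rewrite -/(pend v').
have [uu' euu] := pcat_ex eu; have [vv evv] := pcat_ex ev.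
exists uu', s, vv; split=> //; apply/pcat3P.
rewrite (pend_pcat euu) (pstart_pcat evv) (pstart_pcat euu) b4 a4.
by move/pcatP: euu => [_ _ ->]; move/pcatP: evv => [_ _ ->]; rewrite -!catA.
Qed.

End PathProducts.

(** * Length admissible orders *)

Section AdmissibleOrder.
Variables (Q : quiver) (le : rel (qpath Q)).
Hypothesis leA : length_admissible le.
Implicit Types p q r : qpath Q.

Lemma le_total : total le.
Proof.
move=> p q; apply: (@wochoice.wo_chainW _ le predT) => // A _ nA.
exact: (la_wo leA nA).
Qed.

Lemma le_refl : reflexive le.
Proof. by move=> p; have := le_total p p; rewrite orbb. Qed.

Lemma le_anti : antisymmetric le.
Proof.
move=> p q lpq.
apply: (@wochoice.wo_chain_antisymmetric _ le predT) => // A _ nA.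
exact: (la_wo leA nA).
Qed.

(** The minimum of {p, q, r} is p, or else antisymmetry identifies it with p or
q with r. *)
Lemma le_trans : transitive le.
Proof.
move=> q p r lpq lqr.
have [|z [[]]] := @la_wo _ _ leA (pred3 p q r).
  by exists p; rewrite !inE eqxx.
rewrite !inE => /or3P[]/eqP-> zmin _.
- by apply: zmin; rewrite !inE eqxx !orbT.
- have /le_anti-> // : le p q && le q p.
  by rewrite lpq zmin // !inE eqxx.
- have /le_anti <- // : le q r && le r q.
  by rewrite lqr zmin // !inE eqxx ?orbT.
Qed.

Lemma psucc_ind (P : qpath Q -> Prop) :
  (forall p, (forall q, psucc le p q -> P q) -> P p) -> forall p, P p.
Proof.
move=> IH p; apply: contrapT => nPp.
have [|z [[]]] := @la_wo _ _ leA (fun q => ~~ `[< P q >]).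
  by exists p; apply/asboolPn.
move=> /asboolPn nPz zmin _; apply: nPz; apply: IH => q /andP[nqz lqz].
apply: contrapT => /asboolPn nPq; move/eqP: nqz; apply; apply: le_anti.
by rewrite lqz; apply: zmin.
Qed.

Lemma psucc_pcat3 u v p q r s :
  pcat3 u p v = Some r -> pcat3 u q v = Some s -> psucc le p q -> psucc le r s.
Proof.
rewrite /pcat3; case E1: (pcat u p) => [a|] //= F1; case E2: (pcat u q) => [b|] //= F2.
by move=> pq; apply: (la_mulr leA F1 F2); apply: (la_mull leA E1 E2).
Qed.

Lemma seq_max (s : seq (qpath Q)) :
  s != [::] -> exists2 m, m \in s & {in s, forall q, le q m}.
Proof.
elim: s => // a s IH _; have [->|/IH [m ms mmax]] := eqVneq s [::].
  by exists a; rewrite ?mem_head // => q; rewrite inE => /eqP->; apply: le_refl.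
case/orP: (le_total a m) => lam.
  exists m; first by rewrite inE ms orbT.
  by move=> q; rewrite inE => /orP[/eqP->|/mmax].
exists a; first exact: mem_head.
move=> q; rewrite inE => /orP[/eqP->|/mmax lqm]; first exact: le_refl.
exact: le_trans lqm lam.
Qed.

End AdmissibleOrder.

(** * Ideals of the path algebra *)

Lemma sub_sum_scale (R : pzRingType) (V : lmodType R) (J : finType) (c : J -> R)
    (a : V) (f g : J -> V) :
  (a - \sum_j c j *: g j = (a - \sum_j c j *: f j) + \sum_j c j *: (f j - g j))%R.
Proof.
rewrite (eq_bigr (fun j => c j *: f j - c j *: g j)%R (F1 := fun j => c j *: (f j - g j))%R).
  by rewrite sumrB addrA subrK.
by move=> j _; rewrite scalerBr.
Qed.

Section PathAlgebraIdeals.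
Local Open Scope ring_scope.
Local Open Scope classical_set_scope.
Variables (K : fieldType) (Q : quiver).
Local Notation KQ := (pathalg K Q).
Implicit Types (x y : KQ) (p q r u v : qpath Q).

Definition coef p x : K := monalg.mcoeff p x.

Lemma coef0 p : coef p 0 = 0.
Proof. exact: monalg.mcoeff0. Qed.

Lemma coefD p x y : coef p (x + y) = coef p x + coef p y.
Proof. exact: monalg.mcoeffD. Qed.

Lemma coefB p x y : coef p (x - y) = coef p x - coef p y.
Proof. exact: monalg.mcoeffB. Qed.

Lemma coefZ p c x : coef p (c *: x) = c * coef p x.
Proof. exact: monalg.mcoeffZ. Qed.

Lemma coef_sum p I (s : seq I) (P : pred I) (F : I -> KQ) :
  coef p (\sum_(i <- s | P i) F i) = \sum_(i <- s | P i) coef p (F i).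
Proof. exact: (big_morph (coef p) (coefD p) (coef0 p)). Qed.

Lemma coef_pbase p q : coef p (pbase K q) = (q == p)%:R.
Proof. exact: mcoeffU. Qed.

Lemma coef_pterm p o : coef p (pterm 1 o) = (o == Some p)%:R :> K.
Proof. by case: o => [q|]; [apply: coef_pbase | apply: coef0]. Qed.

Lemma coef_neq0 p x : (coef p x != 0) = (p \in monalg.msupp x).
Proof. exact: mcoeff_neq0. Qed.

Lemma coef_inj x y : (forall p, coef p x = coef p y) -> x = y.
Proof. by move=> h; apply/malgP. Qed.

Lemma pathalgE x : x = \sum_(p <- monalg.msupp x) coef p x *: pbase K p.
Proof.
rewrite {1}[x]monalgE; apply: eq_bigr => p _.
by rewrite -[RHS]mkmalgUZ mulr1.
Qed.

Lemma mul_suppl x y :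
  x * y = \sum_(p <- monalg.msupp x) coef p x *: (pbase K p * y).
Proof.
rewrite -[LHS]/(pa_mul x y) {1}[x]pathalgE pa_mul_suml.
by apply: eq_bigr => p _; rewrite pa_scaleAl.
Qed.

Lemma mul_suppr x y :
  x * y = \sum_(p <- monalg.msupp y) coef p y *: (x * pbase K p).
Proof.
rewrite -[LHS]/(pa_mul x y) {1}[y]pathalgE pa_mul_sumr.
by apply: eq_bigr => p _; rewrite pa_scaleAr.
Qed.

Lemma pbase3 u q v : pbase K u * pbase K q * pbase K v = pterm 1 (pcat3 u q v).
Proof.
rewrite pbaseM /pcat3; case: (pcat u q) => [s|] /=; last by rewrite mul0r.
by rewrite pbaseM; case: (pcat s v).
Qed.

Lemma mul3B u v x y :
  pbase K u * (x - y) * pbase K v = pbase K u * x * pbase K v - pbase K u * y * pbase K v.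
Proof. by rewrite mulrBr mulrBl. Qed.

Definition subspace (W : set KQ) : Prop :=
  [/\ W 0, forall x y, W x -> W y -> W (x + y) & forall c x, W x -> W (c *: x)].

Lemma subspaceB W x y : subspace W -> W x -> W y -> W (x - y).
Proof. by case=> _ WD WZ Wx Wy; rewrite -scaleN1r; apply/WD/WZ. Qed.

Lemma subspace_sum W I (s : seq I) (P : pred I) (F : I -> KQ) :
  subspace W -> (forall i, P i -> W (F i)) -> W (\sum_(i <- s | P i) F i).
Proof. by case=> W0 WD _ WF; apply: (big_ind W). Qed.

Lemma ideal_gen_ideal (R : pzRingType) (G : set R) : two_sided_ideal (ideal_gen G).
Proof.
split=> [I [] //|x y Gx Gy I II GI|a x b Gx I II GI]; case: (II) => I0 IB IM.
- by apply: IB; [apply: Gx | apply: Gy].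
- by apply: IM; apply: Gx.
Qed.

Lemma ideal_gen_sub (R : pzRingType) (G : set R) : G `<=` ideal_gen G.
Proof. by move=> x Gx I _; apply. Qed.

Lemma ideal_gen_le (R : pzRingType) (G H : set R) :
  G `<=` ideal_gen H -> ideal_gen G `<=` ideal_gen H.
Proof. by move=> GH x; apply => //; apply: ideal_gen_ideal. Qed.

Lemma ideal_subspace (I : set KQ) : two_sided_ideal I -> subspace I.
Proof.
case=> I0 IB IM.
have IZ c x : I x -> I (c *: x).
  move=> Ix; suff -> : c *: x = (c *: pa_one K Q) * x * 1 by apply: IM.
  by rewrite mulr1 -pa_scaleAl -[pa_one K Q * x]/(pa_mul _ x) pa_mul1l.
split=> // x y Ix Iy; suff -> : x + y = x - (-1 *: y) by apply/IB/IZ.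
by rewrite scaleN1r opprK.
Qed.

(** Paths span the path algebra. *)
Lemma subspace_mul (W : set KQ) x : subspace W ->
  (forall u v, W (pbase K u * x * pbase K v)) -> forall a b, W (a * x * b).
Proof.
move=> sW Wuv a b; case: (sW) => _ _ WZ.
rewrite mul_suppr; apply: subspace_sum => // v _; apply: (WZ).
rewrite -mulrA mul_suppl; apply: subspace_sum => // u _; apply: (WZ).
by rewrite mulrA.
Qed.

(** The span of the products u g v, with u, v paths, is already an ideal; so a
linear condition on an ideal need only be checked on these products. *)
Lemma ideal_gen_subspace (W G : set KQ) : subspace W ->
  (forall u v g, G g -> W (pbase K u * g * pbase K v)) -> ideal_gen G `<=` W.
Proof.
move=> sW WG x Gx.
(* Unlike W, the set of all x with every u x v in W is a two-sided ideal. *)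
suff Wx : [set x | forall u v, W (pbase K u * x * pbase K v)] x.
  by rewrite -[x]mul1r -[_ * x]mulr1; apply: subspace_mul.
apply: Gx; last by move=> g Gg u v; apply: WG.
split=> [u v|y z Wy Wz u v|a y b Wy u v].
- by rewrite mulr0 mul0r; case: sW.
- by rewrite mulrBr mulrBl; apply: subspaceB.
- have -> : pbase K u * (a * y * b) * pbase K v =
            (pbase K u * a) * y * (b * pbase K v).
    rewrite (mulrA (pbase K u) (a * y) b) (mulrA (pbase K u) a y).
    exact/esym/mulrA.
  exact: (subspace_mul sW Wy).
Qed.

Lemma coef_path_ideal (S : set (qpath Q)) x p :
  path_ideal S x -> coef p x != 0 -> contains S p.
Proof.
move=> Sx; move: p.
apply: (@ideal_gen_subspace [set y | forall p, coef p y != 0 -> contains S p]) Sx.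
  split=> [p|y z Sy Sz p|c y Sy p]; first by rewrite coef0 eqxx.
    rewrite coefD; have [e|/Sy //] := eqVneq (coef p y) 0.
    by rewrite e add0r => /Sz.
  by rewrite coefZ mulf_eq0 negb_or => /andP[_ /Sy].
move=> u v _ [q Sq <-] p; rewrite pbase3 coef_pterm.
by case: (_ =P Some p) => [e _|_ /eqP//]; exists u, q, v.
Qed.

Lemma path_idealP (S : set (qpath Q)) p : path_ideal S (pbase K p) <-> contains S p.
Proof.
split=> [/(@coef_path_ideal S _ p)|[u [q [v [Sq e]]]]].
  by rewrite coef_pbase eqxx oner_eq0; apply.
have -> : pbase K p = pbase K u * pbase K q * pbase K v by rewrite pbase3 e.
case: (ideal_gen_ideal (@pbase K Q @` S)) => _ _; apply.
by apply: ideal_gen_sub; exists q.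
Qed.

Lemma pbase_neq0 p : pbase K p != 0.
Proof.
by apply/eqP => /(congr1 (coef p))/eqP; rewrite coef0 coef_pbase eqxx oner_eq0.
Qed.

Definition linext (f : qpath Q -> KQ) x : KQ :=
  \sum_(p <- monalg.msupp x) coef p x *: f p.

Lemma linextw f x (d : {fset qpath Q}) : (monalg.msupp x `<=` d)%fset ->
  linext f x = \sum_(p <- d) coef p x *: f p.
Proof.
move=> le; apply: (big_fset_incl _ le) => p _ /mcoeff_outdom xp.
by rewrite /coef xp scale0r.
Qed.

Lemma linextD f x y : linext f (x + y) = linext f x + linext f y.
Proof.
rewrite (linextw f (monalg.msuppD_le x y)) (linextw f (fsubsetUl _ (monalg.msupp y))).
rewrite (linextw f (fsubsetUr (monalg.msupp x) _)) -big_split.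
by apply: eq_bigr => p _; rewrite coefD scalerDl.
Qed.

Lemma linextZ f c x : linext f (c *: x) = c *: linext f x.
Proof.
rewrite (linextw f (monalg.msuppZ_le c x)) scaler_sumr.
by apply: eq_bigr => p _; rewrite coefZ scalerA.
Qed.

Lemma linext0 f : linext f 0 = 0.
Proof. by rewrite -(scale0r (0 : KQ)) linextZ !scale0r. Qed.

Lemma linextB f x y : linext f (x - y) = linext f x - linext f y.
Proof. by rewrite -!scaleN1r linextD linextZ. Qed.

Lemma linext_sum f I (s : seq I) (P : pred I) (F : I -> KQ) :
  linext f (\sum_(i <- s | P i) F i) = \sum_(i <- s | P i) linext f (F i).
Proof. exact: (big_morph (linext f) (linextD f) (linext0 f)). Qed.

Lemma linext_pbase f p : linext f (pbase K p) = f p.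
Proof.
have le : (monalg.msupp (pbase K p) `<=` [fset p])%fset by apply: msuppU_le.
by rewrite (linextw f le) big_seq_fset1 coef_pbase eqxx scale1r.
Qed.

End PathAlgebraIdeals.

(** * Polynomial functions on affine space *)

Section PolynomialFunctions.
Local Open Scope ring_scope.
Variables (K : fieldType) (n : nat).
Implicit Types g h : ('I_n -> K) -> K.

(** Being polynomial is kept as a property of functions: over a finite field
several polynomials take the same values, and any of them serves as an equation. *)
Definition polyfun g : Prop := exists f : {mpoly K[n]}, forall X, g X = f.@[X].

Lemma polyfun_cst c : polyfun (fun _ => c).
Proof. by exists c%:MP_[n] => X; rewrite mevalC. Qed.

Lemma polyfun_coord i : polyfun (fun X => X i).
Proof. by exists 'X_i => X; rewrite mevalXU. Qed.

Lemma polyfunB g h : polyfun g -> polyfun h -> polyfun (fun X => g X - h X).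
Proof. by move=> [a ga] [b hb]; exists (a - b) => X; rewrite mevalB ga hb. Qed.

Lemma polyfunM g h : polyfun g -> polyfun h -> polyfun (fun X => g X * h X).
Proof. by move=> [a ga] [b hb]; exists (a * b) => X; rewrite mevalM ga hb. Qed.

Lemma polyfun_sum (J : finType) (g : J -> ('I_n -> K) -> K) :
  (forall j, polyfun (g j)) -> polyfun (fun X => \sum_j g j X).
Proof.
move=> gP; have [f fE] := choice gP; exists (\sum_j f j) => X.
by rewrite raddf_sum; apply: eq_bigr => j _; apply: fE.
Qed.

Lemma eq_polyfun g h : (forall X, g X = h X) -> polyfun g -> polyfun h.
Proof. by move=> gh [f fE]; exists f => X; rewrite -gh. Qed.

End PolynomialFunctions.

(** * Normal forms and strong Koszulity *)

Section NormalForms.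
Local Open Scope ring_scope.
Local Open Scope classical_set_scope.
Variables (K : fieldType) (Q : quiver) (le : rel (qpath Q)) (T : {fset qpath Q}).
Hypothesis leA : length_admissible le.
Hypothesis T2 : forall t, t \in T -> plength t = 2%N.
Local Notation KQ := (pathalg K Q).
Local Notation AK := (affine_space K le T).
Local Notation normal := (normal_paths K le T).
Local Notation normal2 := (normal2 K le T).
Local Notation I X := (ideal_gen (@gset K Q le T X)).
Implicit Types (x y : KQ) (p q u v : qpath Q) (t : T) (X : AK).

Lemma normalP p : normal p <-> ~ contains [set` T] p.
Proof.
split=> [np Tp|np [x [Tx _ [px _]]]].
  apply: np; exists (pbase K p); split; first exact/path_idealP.
    exact: pbase_neq0.
  rewrite /is_tip -coef_neq0 coef_pbase eqxx oner_eq0; split=> // q.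
  rewrite -coef_neq0 coef_pbase.
  by have [->|] := eqVneq p q; [move=> _; apply: le_refl | rewrite eqxx].
by apply: np; apply: (coef_path_ideal Tx); rewrite coef_neq0.
Qed.

Lemma normal_notin p : normal p -> p \notin T.
Proof. by move/normalP => np; apply/negP => pT; apply/np/contains_refl. Qed.

Lemma coef_gelt X t p : coef p (gelt X t) =
  (val t == p)%:R - \sum_(n : normal2 (val t)) coordinate X n * (val n == p)%:R.
Proof.
rewrite coefB coef_pbase coef_sum; congr (_ - _).
by apply: eq_bigr => n _; rewrite coefZ coef_pbase.
Qed.

Lemma coef_gelt_neq0 X t p : coef p (gelt X t) != 0 ->
  p = val t \/ p \in normal2 (val t).
Proof.
have [->|nt] := eqVneq p (val t); first by left.
move=> /eqP cp; right; apply: contrapT => pn; apply: cp.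
rewrite coef_gelt eq_sym (negbTE nt) big1 ?subr0 // => n _.
have [e|] := eqVneq (val n) p; last by rewrite mulr0.
by case: pn; rewrite -e; apply: valP.
Qed.

(** The other paths of g_t are normal, so g_t contains no element of T but t;
hence the coefficients of a combination of the g_t can be read off at T. *)
Lemma coef_gelt_rel X t t' : coef (val t') (gelt X t) = (t == t')%:R.
Proof.
rewrite coef_gelt big1 ?subr0 // => n _.
have /normal2P[/normal_notin nT _ _ _] := valP n.
have [e|] := eqVneq (val n) (val t'); last by rewrite mulr0.
by case/negP: nT; rewrite e; apply: valP.
Qed.

Lemma gelt_support X t p : coef p (gelt X t) != 0 ->
  [/\ plength p = 2%N, le p (val t), pstart p = pstart (val t) & pend p = pend (val t)].
Proof.
case/coef_gelt_neq0 => [->|/normal2P[_ p2 /andP[_ lp] []]] //.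
by split=> //; [apply/T2/valP | apply: le_refl].
Qed.

Lemma gelt_tip X t : is_tip le (gelt X t) (val t).
Proof.
rewrite /is_tip -coef_neq0 coef_gelt_rel eqxx oner_eq0; split=> // q.
by rewrite -coef_neq0 => /gelt_support[].
Qed.

Lemma gelt_neq0 X t : gelt X t != 0.
Proof.
apply/eqP => /(congr1 (coef (val t)))/eqP.
by rewrite coef0 coef_gelt_rel eqxx oner_eq0.
Qed.

Lemma mul_gelt u v X t : pbase K u * gelt X t * pbase K v =
  pterm 1 (pcat3 u (val t) v) -
  \sum_(n : normal2 (val t)) coordinate X n *: pterm 1 (pcat3 u (val n) v).
Proof.
have sumE : pbase K u * (\sum_(n : normal2 (val t)) coordinate X n *: pbase K (val n))
    * pbase K v = \sum_(n : normal2 (val t)) coordinate X n *: pterm 1 (pcat3 u (val n) v).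
  rewrite -[LHS]/(pa_mul (pa_mul _ _) _) pa_mul_sumr pa_mul_suml.
  apply: eq_bigr => n _; rewrite -pbase3.
  by rewrite -[LHS]/((pbase K u * (coordinate X n *: pbase K (val n))) * pbase K v)
    -pa_scaleAr -pa_scaleAl.
apply: etrans (mul3B _ _ _ _) _.
exact: (f_equal2 (fun a b : KQ => a - b) (pbase3 _ _ _ _) sumE).
Qed.

Lemma gelt_uniform X t :
  gelt X t = pbase K (pvertex (pstart (val t))) * gelt X t *
             pbase K (pvertex (pend (val t))).
Proof.
apply/esym; apply: etrans (mul_gelt _ _ _ _) _.
apply: (f_equal2 (fun a b : KQ => a - b)); first by rewrite pcat3_vertices.
apply: eq_bigr => n _.
by have /normal2P[_ _ _ [<- <-]] := valP n; rewrite pcat3_vertices.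
Qed.

Lemma ideal_gelt X t u v : I X (pbase K u * gelt X t * pbase K v).
Proof.
case: (ideal_gen_ideal (gset X)) => _ _; apply; apply: ideal_gen_sub.
by exists t.
Qed.

(** r X is a result of rewriting p by the rules t -> sum of x_{t,n} n, uniformly
in X.  The bound by p on the paths that occur keeps the tip of an element from
being cancelled by the normal forms of its smaller paths. *)
Definition normal_form p (r : AK -> KQ) : Prop :=
  [/\ forall X n, coef n (r X) != 0 -> normal n /\ le n p,
      forall X, I X (pbase K p - r X),
      normal p -> forall X, r X = pbase K p
    & forall n, polyfun (fun X => coef n (r X))].

(** If p = u t v with t in T, then p is congruent to the sum of the x_{t,n} u n v;
the paths u n v are smaller than p, and have normal forms by induction. *)
Lemma normal_form_ex p : exists r, normal_form p r.
Proof.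
elim/(psucc_ind leA): p => p IH.
have [np|] := EM (normal p).
  exists (fun=> pbase K p); split=> //.
  - move=> X n; rewrite coef_pbase.
    have [<- _|] := eqVneq p n; last by rewrite eqxx.
    by split=> //; apply: le_refl.
  - by move=> X; rewrite subrr; case: (ideal_gen_ideal (gset X)).
  - by move=> n; apply: polyfun_cst.
move/normalP/contrapT => [u [t0 [v [tT pE]]]]; pose t : T := [` tT]%fset.
(* n is parallel to t, so that u n v is again a path. *)
have red (n : normal2 (val t)) :
    exists m, pcat3 u (val n) v = Some m /\ exists r, normal_form m r.
  have /normal2P[_ _ tn [sn en]] := valP n.
  have [m mE] : exists m, pcat3 u (val n) v = Some m.
    by case/pcat3P: pE => e1 e2 _ _; apply: pcat3_ex; rewrite ?sn ?en.
  by exists m; split=> //; apply: IH; apply: (psucc_pcat3 leA pE mE tn).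
have [m mP] := choice red.
have [r rP] := choice (fun n => proj2 (mP n)).
exists (fun X => \sum_(n : normal2 (val t)) coordinate X n *: r n X); split.
- move=> X q cq.
  have [n cn] : exists n, coef q (r n X) != 0.
    apply: contrapT => nq; move/eqP: cq; apply; rewrite coef_sum big1 // => n _.
    rewrite coefZ; have [->|cn] := eqVneq (coef q (r n X)) 0; first exact: mulr0.
    by case: nq; exists n.
  have [/(_ X q cn)[nq lq] _ _ _] := rP n; split=> //.
  apply: (le_trans leA lq).
  have /normal2P[_ _ tn _] := valP n.
  by have /andP[] := psucc_pcat3 leA pE (proj1 (mP n)) tn.
- move=> X; have sI := ideal_subspace (ideal_gen_ideal (gset X)).
  have [_ ID IZ] := sI.
  have gE : pbase K u * gelt X t * pbase K v =
      pbase K p - \sum_(n : normal2 (val t)) coordinate X n *: pbase K (m n).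
    apply: etrans (mul_gelt _ _ _ _) _.
    apply: (f_equal2 (fun a b : KQ => a - b)); first by rewrite pE.
    by apply: eq_bigr => n _; rewrite (proj1 (mP n)).
  have {}gE := etrans (congr1 (fun z : KQ => z + _) gE)
    (esym (sub_sum_scale (V := KQ) _ _ (fun n => pbase K (m n)) (fun n => r n X))).
  rewrite -gE; apply: ID; first exact: ideal_gelt.
  by apply: subspace_sum => // n _; apply: IZ; case: (rP n).
- by move/normalP => np; case: np; exists u, t0, v.
- move=> q; apply: (@eq_polyfun _ _ (fun X => \sum_n coordinate X n * coef q (r n X))).
    by move=> X; rewrite coef_sum; apply: eq_bigr => n _; rewrite coefZ.
  apply: polyfun_sum => n; apply: polyfunM; first exact: polyfun_coord.
  by case: (rP n).
Qed.

Section Reduction.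
Variable r : qpath Q -> AK -> KQ.
Hypothesis rP : forall p, normal_form p (r p).
Local Notation NF X := (linext (fun p => r p X)).

Lemma coef_linext (f : qpath Q -> KQ) n x :
  coef n (linext f x) = \sum_(p <- monalg.msupp x) coef p x * coef n (f p).
Proof. by rewrite coef_sum; apply: eq_bigr => p _; rewrite coefZ. Qed.

Lemma NF_normal X x n : coef n (NF X x) != 0 -> normal n.
Proof.
move=> cn; apply: contrapT => nn; move/eqP: cn; apply.
rewrite coef_linext big1 // => p _.
have [->|/(let: And4 h _ _ _ := rP p in h X n)[]//] := eqVneq (coef n (r p X)) 0.
exact: mulr0.
Qed.

Lemma NF_mod X x : I X (x - NF X x).
Proof.
have sI := ideal_subspace (ideal_gen_ideal (gset X)).
rewrite {1}[x]pathalgE -sumrB; apply: subspace_sum => // p _.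
by rewrite -scalerBr; case: sI => _ _; apply; case: (rP p).
Qed.

Lemma NF_ideal X x : I X x -> I X (NF X x).
Proof.
move=> Ix; rewrite (_ : NF X x = x - (x - NF X x)); last by rewrite opprB addrC subrK.
apply: (@subspaceB _ _ (I X)) => //; last exact: NF_mod.
exact: ideal_subspace (ideal_gen_ideal _).
Qed.

Lemma NF_id X x : (forall p, coef p x != 0 -> normal p) -> NF X x = x.
Proof.
move=> nx; rewrite [RHS]pathalgE; apply: eq_big_seq => p.
by rewrite -coef_neq0 => /nx np; case: (rP p) => _ _ -> .
Qed.

(** Every path q < p contributes to NF x only paths up to q, and p itself
contributes p. *)
Lemma NF_tip X x p : is_tip le x p -> normal p -> coef p (NF X x) = coef p x.
Proof.
move=> [px xp] np; rewrite coef_linext (big_rem p) //=.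
have [_ _ -> // _] := rP p.
rewrite coef_pbase eqxx mulr1 big_seq big1 ?addr0 // => q.
rewrite mem_rem_uniq ?fset_uniq // inE => /andP[nqp qx].
have [->|/(let: And4 h _ _ _ := rP q in h X p)[_ lpq]] := eqVneq (coef p (r q X)) 0.
  exact: mulr0.
by case/eqP: nqp; apply: (le_anti leA); rewrite lpq xp.
Qed.

Lemma polyfun_NF n u v t :
  polyfun (fun X => coef n (NF X (pbase K u * gelt X t * pbase K v))).
Proof.
have P o : polyfun (fun X => coef n (NF X (pterm 1 o))).
  case: o => [p|] /=; last first.
    by apply: (eq_polyfun _ (polyfun_cst _ 0)) => X; rewrite linext0 coef0.
  by case: (rP p) => _ _ _ /(_ n); apply: eq_polyfun => X; rewrite linext_pbase.
apply: (@eq_polyfun _ _ (fun X => coef n (NF X (pterm 1 (pcat3 u (val t) v))) -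
    \sum_(m : normal2 (val t))
       coordinate X m * coef n (NF X (pterm 1 (pcat3 u (val m) v))))).
  move=> X; rewrite mul_gelt linextB linext_sum coefB coef_sum; congr (_ - _).
  by apply: eq_bigr => m _; rewrite linextZ coefZ.
apply: polyfunB => //; apply: polyfun_sum => m; apply: polyfunM => //.
exact: polyfun_coord.
Qed.

End Reduction.

(** Among the products u g_t v, which span I X, those that have length 2 are the
g_t, multiplied by the vertices at their two ends. *)
Lemma ideal_quadratic_part X x : I X x -> exists c : T -> K,
  forall p, plength p = 2%N -> coef p x = \sum_t c t * coef p (gelt X t).
Proof.
move: x; apply: ideal_gen_subspace.
  split=> [|x y [c cP] [d dP]|a x [c cP]].
  - by exists (fun=> 0) => p _; rewrite coef0 big1 // => t _; apply: mul0r.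
  - exists (fun t => c t + d t) => p p2; rewrite coefD cP // dP // -big_split.
    by apply: eq_bigr => t _; rewrite mulrDl.
  - exists (fun t => a * c t) => p p2; rewrite coefZ cP // mulr_sumr.
    by apply: eq_bigr => t _; rewrite mulrA.
move=> u v _ [t _ <-].
have [e|ne] := EM (u = pvertex (pstart (val t)) /\ v = pvertex (pend (val t))).
  exists (fun t' => (t == t')%:R) => p _; case: e => -> ->; rewrite -gelt_uniform.
  rewrite (bigD1 t) //= eqxx mul1r big1 ?addr0 // => t'.
  by rewrite eq_sym => /negbTE->; apply: mul0r.
exists (fun=> 0) => p p2; rewrite [RHS]big1 => [|t' _]; last exact: mul0r.
(* A path u q v of length 2 would force u and v to be the excluded vertices. *)
have nE q : plength q = 2%N -> pstart q = pstart (val t) -> pend q = pend (val t) ->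
    coef p (pterm 1 (pcat3 u q v)) = 0 :> K.
  move=> q2 sq eq; rewrite coef_pterm; have [E|//] := eqVneq; case: ne.
  move: (plength_pcat3 E); rewrite p2 q2 => /eqP.
  rewrite addnCA -[X in X == _]addn0 eqn_add2l eq_sym addn_eq0 => /andP[/eqP u0 /eqP v0].
  move/pcat3P: E => [E1 E2 _ _].
  by rewrite (plength0 u0) (plength0 v0) -sq -eq -E1 E2 pend_plength0.
rewrite mul_gelt coefB coef_sum nE ?sub0r //; last exact/T2/valP.
rewrite big1 ?oppr0 // => n _; rewrite coefZ.
by have /normal2P[_ n2 _ [sn en]] := valP n; rewrite nE ?mulr0.
Qed.

(** x is the combination of the g_t whose coefficients c_t are those of x at T.
If its tip p were outside T, it would be one of the n in some g_t with c_t
nonzero; but then the larger path t also occurs in x. *)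
Lemma quadratic_tip X x p : I X x -> quadratic x -> is_tip le x p -> p \in T.
Proof.
move=> Ix x2 [px xp]; apply: contrapT => /negP pT.
have [c cP] := ideal_quadratic_part Ix.
have cT t : coef (val t) x = c t.
  rewrite cP; last exact/T2/valP.
  rewrite (bigD1 t) //= coef_gelt_rel eqxx mulr1 big1 ?addr0 // => t' nt.
  by rewrite coef_gelt_rel (negbTE nt) mulr0.
move: (px); rewrite -coef_neq0 cP ?x2 // => /eqP; apply.
apply: big1 => t _.
have [->|ct] := eqVneq (c t) 0; first exact: mul0r.
have [->|/coef_gelt_neq0[e|]] := eqVneq (coef p (gelt X t)) 0; first exact: mulr0.
  by case/negP: pT; rewrite e; apply: valP.
move/normal2P => [_ _ /andP[npt lpt] _]; case/eqP: npt; apply: (le_anti leA).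
by rewrite lpt xp // -coef_neq0 cT.
Qed.

(** This removes the existential quantifier over Groebner bases.  Through normal
forms, the right-hand side means that no tip of I X is normal, that is, that
every tip of I X contains the tip of some g_t. *)
Lemma GrAlgP X : GrAlg X <->
  (forall x, I X x -> (forall p, coef p x != 0 -> normal p) -> x = 0).
Proof.
split=> [[G [_ GI _ GB] G2] x Ix nx|Inormal].
  apply: contrapT => /eqP x0.
  have [|p px xp] := @seq_max Q le leA (monalg.msupp x).
    apply: contra x0 => /eqP sx; apply/eqP/coef_inj => p; rewrite coef0.
    by apply/eqP/negPn; rewrite coef_neq0 -[_ \in _]/(p \in enum_fset _) sx.
  have /normalP : normal p by apply: nx; rewrite coef_neq0.
  apply.
  have : path_ideal (tip le (I X)) (pbase K p).
    by apply: ideal_gen_sub; exists p => //; exists x.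
  rewrite -GB => /path_idealP; apply: contains_trans => q [g [Gg _ gq]].
  by apply/contains_refl/(quadratic_tip (GI _ Gg) (G2 _ Gg) gq).
have gelt2 t : quadratic (gelt X t).
  by move=> p; rewrite -coef_neq0 => /gelt_support[].
exists (gset X); last by move=> _ [t _ <-]; apply: gelt2.
split.
- by exists (gset X) => // _ [t _ <-]; exists 2%N; apply: gelt2.
- exact: ideal_gen_sub.
- move=> _ [t _ <-]; split; first by exists 2%N; apply: gelt2.
  split; first exact: gelt_neq0.
  by do 2!eexists; apply: gelt_uniform.
apply/seteqP; split; apply: ideal_gen_le => _ [p [x [Ix x0 xp]] <-].
  apply: ideal_gen_sub; exists p => //; exists x; split=> //.
  exact: ideal_gen_sub.
apply/path_idealP; apply: (@contains_trans _ [set` T]) => [t tT|].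
  apply: contains_refl; exists (gelt X [` tT]%fset); split.
  - by exists [` tT]%fset.
  - exact: gelt_neq0.
  - exact: gelt_tip.
apply: contrapT => /normalP np.
have [r rP] := choice normal_form_ex.
case: (xp) => px _; move: px; rewrite -coef_neq0 -(NF_tip rP X xp np) => /eqP; apply.
by rewrite (Inormal _ (NF_ideal rP Ix)) ?coef0 //; apply: NF_normal.
Qed.

End NormalForms.

Theorem theorem3p5 (K : fieldType) (Q : quiver) (le : rel (qpath Q))
    (T : {fset qpath Q}) :
  length_admissible le ->
  (forall t : qpath Q, t \in T -> plength t = 2) ->
  affine_variety (@GrAlg K Q le T).
Proof.
move=> leA T2; have [r rP] := choice (@normal_form_ex K Q le T leA).
pose NF X := linext (fun p => r p X).
exists (fun f => exists n u v t, forall X,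
  f.@[X]%R = coef n (NF X (pbase K u * gelt X t * pbase K v)%R)).
apply/seteqP; split=> X.
  move=> /(GrAlgP leA T2) GX _ [n [u [v [t ->]]]].
  rewrite [NF X _](GX _ (NF_ideal rP (ideal_gelt t u v))) ?coef0 //.
  exact: NF_normal.
move=> FX; apply/(GrAlgP leA T2) => x Ix nx.
rewrite -(NF_id rP X nx).
apply: (@ideal_gen_subspace _ _ [set y | NF X y = 0%R]) Ix.
  split=> [|y z|c y]; rewrite /= /NF; first exact: linext0.
    by rewrite linextD => -> ->; rewrite addr0.
  by rewrite linextZ => ->; rewrite scaler0.
move=> u v _ [t _ <-]; apply: coef_inj => n; rewrite coef0.
have [f fE] := polyfun_NF rP n u v t.
by rewrite [LHS]fE; apply: FX; exists n, u, v, t => Y; rewrite -fE.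
Qed.
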